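(* Let $P$ be a finite poset, $\mathbb{S}$ a skew field containing an infinite field as a subfield, $C$ a central element of $\mathbb{S}$, and $v\in P$ with $v_1,\dots,v_k$ the elements of $P$ covered by $v$. Let $T_v^*=\varepsilon_{v_1}\varepsilon_{v_2}\cdots\varepsilon_{v_k}\tau_v\tau_{v_k}\cdots\tau_{v_2}\tau_{v_1}$ and $E_v^*=\varepsilon_{v_1}\varepsilon_{v_2}\cdots\varepsilon_{v_k}\varepsilon_v\tau_{v_k}\cdots\tau_{v_2}\tau_{v_1}$ (for minimal $v$, $T_v^*=\tau_v$, $E_v^*=\varepsilon_v$). Then, on the domains where the maps are defined, $$\Theta\circ\Delta^{-1}\circ T_v^*=T_v\circ\Theta\circ\Delta^{-1}\quad\text{and}\quad\Theta\circ\Delta^{-1}\circ E_v^*=E_v\circ\Theta\circ\Delta^{-1}.$$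
   Context: $\mathbb{S}^P$ is the set of labelings $P\to\mathbb{S}$; products denote composition, rightmost first; $\overline{x}=x^{-1}$; the parallel sum of $z_1,\dots,z_m$ is $\sum^{\parallel}_iz_i=\overline{\overline{z_1}+\cdots+\overline{z_m}}$. $\widehat P$ is $P$ with a new minimum $\widehat0$ and maximum $\widehat1$; $x\lessdot y$ means $y$ covers $x$ in $\widehat P$. Order toggle $T_v$ / elggot $E_v$ change only the label at $v$: $(T_vf)(v)=\big(\sum_{u\lessdot v}f(u)\big)\overline{f(v)}\big(\sum^{\parallel}_{u\gtrdot v}f(u)\big)$, $(E_vf)(v)=\big(\sum^{\parallel}_{u\gtrdot v}f(u)\big)\overline{f(v)}\big(\sum_{u\lessdot v}f(u)\big)$, with $f(\widehat0)=1$, $f(\widehat1)=C$. Antichain toggle $\tau_v$ / elggot $\varepsilon_v$ change only the label at $v$: $(\tau_vg)(v)=C\cdot\overline{\sum g(y_{c-1})\cdots g(y_1)\,g(y_k)\cdots g(y_c)}$, $(\varepsilon_vg)(v)=C\cdot\overline{\sum g(y_c)\cdots g(y_1)\,g(y_k)\cdots g(y_{c+1})}$, sums over maximal chains $y_1\lessdot\cdots\lessdot y_k$ of $P$ with $y_c=v$. $(\Theta f)(x)=C\,\overline{f(x)}$; $(\Delta^{-1}f)(x)=\sum f(y_k)\cdots f(y_2)f(y_1)$ over chains $x=y_1\lessdot y_2\lessdot\cdots\lessdot y_k\lessdot\widehat1$. *)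

(* Defs.v *)
From HB Require Import structures.
From mathcomp Require Import all_boot all_order all_algebra.

Set Implicit Arguments.
Unset Strict Implicit.
Unset Printing Implicit Defensive.

Import Order.TTheory GRing.Theory.
Local Open Scope ring_scope.

Definition contains_infinite_field (S : unitRingType) : Prop :=
  exists K : {pred S},
    [/\ divring_closed K,
        {in K &, commutative *%R} &
        forall s : seq S, exists2 x, x \in K & x \notin s].

(* The poset P with a new minimum None and a new maximum Some None; the element
   x of P becomes Some (Some x). *)
Notation hat P := (option (option P)).

Section Hat.

Context {d : Order.disp_t} {P : finPOrderType d}.

Definition hat0 : hat P := None.
Definition hat1 : hat P := Some None.
Definition inhat (x : P) : hat P := Some (Some x).

Definition hat_lt (x y : hat P) : bool :=
  match x, y with
  | None, None => false
  | None, Some _ => true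
  | Some None, _ => false
  | Some (Some _), None => false
  | Some (Some _), Some None => true
  | Some (Some a), Some (Some b) => (a < b)%O
  end.

Definition hat_covers (x y : hat P) : bool :=
  hat_lt x y && ~~ [exists z, hat_lt x z && hat_lt z y].

Definition covers (x y : P) : bool := hat_covers (inhat x) (inhat y).

Definition is_chain (A : {set P}) : bool :=
  [forall x in A, forall y in A, (x >=< y)%O].

Definition maximal_chain (s : seq P) : bool :=
  sorted covers s && maxset is_chain [set y in s].

Definition chain_to_top (x : P) (s : seq P) : bool :=
  (ohead s == Some x) && sorted hat_covers (rcons (map inhat s) hat1).

(* The sum of F over all sequences satisfying A, when A only holds of chains:
   these are strictly increasing, so that their length is at most #|P|. *)
Definition sum_chains (S : nmodType) (A : pred (seq P)) (F : seq P -> S) : S :=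
  \sum_(k < #|P|.+1) \sum_(t : k.-tuple P | A t) F t.

End Hat.

(* A partial map is undefined (None) exactly where evaluating the formula
   defining it requires the inverse of 0. *)
Definition partial_map (T : Type) := T -> option T.

Definition pcomp (T : Type) (F G : partial_map T) : partial_map T := fun x => obind F (G x).

Notation "F \p G" := (pcomp F G) (at level 50, left associativity).

Definition pcomp_seq (T : Type) (s : seq (partial_map T)) : partial_map T :=
  foldr (@pcomp T) Some s.

Definition agree (T : Type) (F G : partial_map T) : Prop :=
  forall x a b, F x = Some a -> G x = Some b -> a = b.

Section Maps.

Context {d : Order.disp_t} {P : finPOrderType d} {S : unitRingType}.

Notation labeling := {ffun P -> S}.

Definition pinv (x : S) : option S := if x == 0 then None else Some x^-1.

Definition parallel_sum (I : finType) (A : pred I) (z : I -> S) : option S :=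
  if [forall (i | A i), z i != 0] then pinv (\sum_(i | A i) (z i)^-1) else None.

Definition set_label (f : labeling) (v : P) (a : S) : labeling :=
  [ffun x => if x == v then a else f x].

Definition hat_label (C : S) (f : labeling) (x : hat P) : S :=
  match x with
  | None => 1
  | Some None => C
  | Some (Some y) => f y
  end.

Definition sum_below (C : S) (f : labeling) (v : P) : S :=
  \sum_(u : hat P | hat_covers u (inhat v)) hat_label C f u.

Definition psum_above (C : S) (f : labeling) (v : P) : option S :=
  parallel_sum (fun u : hat P => hat_covers (inhat v) u) (hat_label C f).

Definition order_toggle (C : S) (v : P) : partial_map labeling := fun f =>
  obind (fun a => omap (fun b => set_label f v (sum_below C f v * a * b))
                       (psum_above C f v))
        (pinv (f v)).

Definition order_elggot (C : S) (v : P) : partial_map labeling := fun f =>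
  obind (fun a => omap (fun b => set_label f v (b * a * sum_below C f v))
                       (psum_above C f v))
        (pinv (f v)).

(* g(y_k) ... g(y_1) for s = [:: y_1; ...; y_k] *)
Definition rev_prod (g : labeling) (s : seq P) : S := \prod_(y <- rev s) g y.

(* index v s is c - 1 when v = y_c in s = [:: y_1; ...; y_k]. *)
Definition antichain_toggle (C : S) (v : P) : partial_map labeling := fun g =>
  omap (fun a => set_label g v (C * a))
    (pinv (sum_chains (fun s => maximal_chain s && (v \in s))
      (fun s => rev_prod g (take (index v s) s)
                * rev_prod g (drop (index v s) s)))).

Definition antichain_elggot (C : S) (v : P) : partial_map labeling := fun g =>
  omap (fun a => set_label g v (C * a))
    (pinv (sum_chains (fun s => maximal_chain s && (v \in s))
      (fun s => rev_prod g (take (index v s).+1 s)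
                * rev_prod g (drop (index v s).+1 s)))).

Definition Theta (C : S) : partial_map labeling := fun f =>
  if [forall x, f x != 0] then Some [ffun x => C * (f x)^-1] else None.

Definition DeltaV : partial_map labeling := fun f =>
  Some [ffun x => sum_chains (chain_to_top x) (rev_prod f)].

(* vs lists the elements covered by v. *)
Definition T_star (C : S) (v : P) (vs : seq P) : partial_map labeling :=
  pcomp_seq (map (antichain_elggot C) vs ++ [:: antichain_toggle C v]
             ++ map (antichain_toggle C) (rev vs)).

Definition E_star (C : S) (v : P) (vs : seq P) : partial_map labeling :=
  pcomp_seq (map (antichain_elggot C) vs ++ [:: antichain_elggot C v]
             ++ map (antichain_toggle C) (rev vs)).

End Maps.

(* Main.v *)
Require Import Defs.
From HB Require Import structures.
From mathcomp Require Import all_boot all_order all_algebra.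

Set Implicit Arguments.
Unset Strict Implicit.
Unset Printing Implicit Defensive.

Import Order.TTheory GRing.Theory.
Local Open Scope ring_scope.

(** Write U(x) for the sum of g(y_k)...g(y_1) over the chains going from above
    x to the top and D(x) for the analogous sum over the chains below x. Then
    F = Delta^{-1} g satisfies F(x) = U(x) g(x), and cutting each maximal chain
    at v turns the sums in the definitions of tau_v and epsilon_v into the
    products D(v) F(v) and (g(v) D(v)) U(v).

    After the toggles at the elements u covered by v (a family of pairwise
    incomparable elements, so they do not interfere) one has
    g(u) D(u) = C F(u)^{-1}, hence D(v) has become the sum of Theta F over the
    elements covered by v, which is the factor needed in T_v and E_v. The final
    elggots at the elements u restore F(u), so that F changes at v only. *)

Lemma big_option (V : nmodType) (T : finType) (F : option T -> V) :
  \sum_u F u = F None + \sum_x F (Some x).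
Proof.
rewrite (bigD1 None) //=; congr (_ + _).
rewrite (reindex_omap Some id) /=; last by case.
by apply: eq_bigl=> x; rewrite eqxx.
Qed.

(** * Covers, and a local description of maximal chains *)

Section Covers.

Context {d : Order.disp_t} {P : finPOrderType d}.
Implicit Types (x y z : P) (s t : seq P).

Definition is_min x := hat_covers hat0 (inhat x).
Definition is_max x := hat_covers (inhat x) hat1.

Lemma covers_lt x y : covers x y -> (x < y)%O.
Proof. by case/andP. Qed.

Lemma covers_between x y z : covers x y -> (x < z)%O -> (z < y)%O -> False.
Proof.
case/andP=> _ /existsPn /(_ (inhat z)) /= nz xz zy.
by rewrite xz zy in nz.
Qed.

Lemma is_minP x : reflect (forall z, ~~ (z < x)%O) (is_min x).
Proof.
apply: (iffP idP) => [/andP[_ /existsPn nz] z | nz].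
  by have := nz (inhat z).
by apply/andP; split=> //; apply/existsPn=> -[[z|]|] //=; exact: nz.
Qed.

Lemma is_maxP x : reflect (forall z, ~~ (x < z)%O) (is_max x).
Proof.
apply: (iffP idP) => [/andP[_ /existsPn nz] z | nz].
  by have := nz (inhat z); rewrite /= andbT.
by apply/andP; split=> //; apply/existsPn=> -[[z|]|] //=; rewrite andbT nz.
Qed.

Lemma hat_covers0 x : hat_covers (inhat x) hat0 = false.
Proof. by []. Qed.

Lemma hat_covers1 x : hat_covers hat1 (inhat x) = false.
Proof. by []. Qed.

Lemma big_covers_above (V : nmodType) (F : hat P -> V) x :
  \sum_(u | hat_covers (inhat x) u) F u =
    (if is_max x then F hat1 else 0) + \sum_(u | covers x u) F (inhat u).
Proof.
rewrite big_mkcond big_option hat_covers0 add0r big_option.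
by congr (_ + _); rewrite -big_mkcond.
Qed.

Lemma big_covers_below (V : nmodType) (F : hat P -> V) x :
  \sum_(u | hat_covers u (inhat x)) F u =
    (if is_min x then F hat0 else 0) + \sum_(u | covers u x) F (inhat u).
Proof.
rewrite big_mkcond !big_option hat_covers1 add0r.
by congr (_ + _); rewrite -big_mkcond.
Qed.

Lemma path_covers_lt x s : path covers x s -> path <%O x s.
Proof. by apply: sub_path=> y z /covers_lt. Qed.

Lemma path_covers_gt x s : path (fun y z => covers z y) x s -> path >%O x s.
Proof. by apply: sub_path=> y z /covers_lt. Qed.

Lemma mem_path_covers_lt x s y : path covers x s -> y \in s -> (x < y)%O.
Proof. by move/path_covers_lt/(order_path_min lt_trans)/allP; apply. Qed.

Lemma mem_path_covers_gt x s y :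
  path (fun y z => covers z y) x s -> y \in s -> (y < x)%O.
Proof.
by move/path_covers_gt/(order_path_min (rev_trans lt_trans))/allP; apply.
Qed.

Lemma sorted_covers_is_chain s : sorted covers s -> is_chain [set y in s].
Proof.
move=> ss; have {ss} : sorted <%O s by case: s ss => //= x s /path_covers_lt.
rewrite (sorted_pairwise lt_trans) => pw.
apply/forall_inP=> x; rewrite inE => xs; apply/forall_inP=> y; rewrite inE => ys.
elim: s pw xs ys => //= a s IH /andP[/allP al pw]; rewrite !inE.
case/predU1P=> [->|xs] /predU1P[->|ys]; rewrite ?comparablexx //.
- by apply: lt_comparable; exact: al.
- by apply: gt_comparable; exact: al.
- exact: IH.
Qed.

(** Follow the chain upwards: if [z] is above [x] and comparable to the next element [a], then it
    equals [a], lies above [a], or lies strictly between [x] and [a], which a cover forbids. Since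
    the last element is maximal, [z] cannot escape at the top. *)
Lemma comparable_path_covers_mem x s z : path covers x s -> is_max (last x s) ->
  (x < z)%O -> (forall y, y \in s -> (y >=< z)%O) -> z \in s.
Proof.
elim: s x => [|a s IH] x /=; first by move=> _ /is_maxP /(_ z) /negbTE ->.
case/andP=> xa pas ml xz cs; rewrite inE.
have := cs a (mem_head _ _); rewrite /Order.comparable !le_eqVlt.
case: eqVneq => //= _ /orP[az|za].
  by apply: IH pas ml az _ => y ys; apply: cs; rewrite inE ys orbT.
by case: (covers_between xa xz za).
Qed.

(** Maximality becomes a condition on the two ends only. An element below the first or above the
    last one could be added to the chain; conversely, an element comparable to a saturated chain
    with extremal ends has no place outside it. *)
Lemma maximal_chain_cons x s :
  maximal_chain (x :: s) = [&& path covers x s, is_min x & is_max (last x s)].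
Proof.
apply/andP/and3P=> [[/= pxs /maxsetP[/forall_inP chs maxs]] | [pxs minx maxl]].
  have ext z : (forall y, y \in x :: s -> (y >=< z)%O) -> z \in x :: s.
    move=> cz; have /setP/(_ z) : z |: [set y in x :: s] = [set y in x :: s].
      apply: maxs (subsetUr _ _); apply/forall_inP=> y1 y1s.
      apply/forall_inP=> y2 y2s; move: y1s y2s; rewrite !inE.
      case/predU1P=> [->|y1s] /predU1P[->|y2s]; rewrite ?comparablexx //.
      - by rewrite comparable_sym cz // inE.
      - by rewrite cz // inE.
      - by apply: (forall_inP (chs y1 _)); rewrite !inE.
    by rewrite !inE eqxx /= => <-.
  split=> //; [apply/is_minP=> z | apply/is_maxP=> z]; apply/negP=> lz.
    have : z \in x :: s.
      apply: ext => y; rewrite inE => /predU1P[->|ys]; apply: gt_comparable => //.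
      exact: lt_trans lz (mem_path_covers_lt pxs ys).
    rewrite inE => /predU1P[zx|zs]; first by rewrite zx ltxx in lz.
    by have := lt_trans lz (mem_path_covers_lt pxs zs); rewrite ltxx.
  (* The last element is the greatest of the chain, so a [z] above it is comparable to every element
     and [ext] applies. *)
  have lel y : y \in x :: s -> (y <= last x s)%O.
    move=> ys; have /= := path_covers_lt pxs.
    case/splitPl: {pxs ext chs maxs lz} ys => p1 p2 <-.
    rewrite cat_path last_cat => /andP[_].
    case/lastP: p2 => //= p2 w /(order_path_min lt_trans)/allP /(_ w).
    by rewrite last_rcons mem_rcons mem_head => /(_ isT)/ltW.
  have /lel : z \in x :: s.
    by apply: ext => y /lel yl; apply: lt_comparable; exact: le_lt_trans yl lz.
  by move/(lt_le_trans lz); rewrite ltxx.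
split=> //=; apply/maxsetP; split; first exact: sorted_covers_is_chain.
move=> B /forall_inP chB sB; apply/eqP; rewrite eqEsubset sB andbT.
apply/subsetP=> z zB; rewrite !inE; case: eqVneq => //= zx.
have cmp y : y \in x :: s -> (y >=< z)%O.
  move=> ys; apply: (forall_inP (chB y _)) => //.
  by apply: (subsetP sB); rewrite inE.
apply: comparable_path_covers_mem pxs maxl _ _ => [|y ys]; last first.
  by apply: cmp; rewrite inE ys orbT.
have := cmp x (mem_head _ _); rewrite /Order.comparable !le_eqVlt (negbTE zx).
by rewrite eq_sym (negbTE zx) (negbTE (is_minP _ minx z)) /= orbF.
Qed.

Lemma chain_to_top_cons x y s : chain_to_top x (y :: s) =
  [&& y == x, path covers y s & is_max (last y s)].
Proof.
rewrite /chain_to_top /=; congr (_ && _).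
by rewrite rcons_path path_map last_map.
Qed.

End Covers.

(** * Enumeration of bounded sequences and of walks along a relation *)

(** The index range of [sum_chains] flattened into one list, so that sums over chains can be
    compared by permuting lists. *)
Definition bounded_seqs (T : finType) : seq (seq T) :=
  [seq tval t | k <- iota 0 #|T|.+1, t <- enum {: k.-tuple T}].

Lemma mem_bounded_seqs (T : finType) (s : seq T) :
  (s \in bounded_seqs T) = (size s <= #|T|)%N.
Proof.
apply/allpairsPdep/idP=> [[k [t []]] | les].
  by rewrite mem_iota add0n => ltk _ ->; rewrite size_tuple -ltnS.
by exists (size s), (in_tuple s); rewrite mem_iota add0n ltnS mem_enum.
Qed.

Lemma uniq_bounded_seqs (T : finType) : uniq (bounded_seqs T).
Proof.
apply: allpairs_uniq_dep => [|k _|]; rewrite ?iota_uniq ?enum_uniq //.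
move=> [k t] [l u] _ _ /= eq_tu.
have eq_kl : k = l by rewrite -(size_tuple t) eq_tu size_tuple.
by subst l; congr Tagged; exact: val_inj.
Qed.

(** Two duplicate-free lists with the same members are permutations of each other, so any convenient
    enumeration [r] may index the sum. *)
Lemma sum_chains_seq (d : Order.disp_t) (P : finPOrderType d) (V : nmodType)
    (A : pred (seq P)) (F : seq P -> V) (r : seq (seq P)) :
  uniq r -> (forall s, (s \in r) = A s && (size s <= #|P|)%N) ->
  sum_chains A F = \sum_(s <- r) F s.
Proof.
move=> ur rE; have pr : perm_eq r [seq s <- bounded_seqs P | A s].
  apply: uniq_perm => // [|s]; first by rewrite filter_uniq ?uniq_bounded_seqs.
  by rewrite mem_filter mem_bounded_seqs.
rewrite (perm_big _ pr) big_filter big_mkcond big_allpairs_dep.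
rewrite -[X in iota 0 X]subn0 -/(index_iota _ _) big_mkord.
apply: eq_bigr => k _; rewrite big_enum [LHS]big_mkcond /=.
by apply: eq_bigl => t; rewrite inE.
Qed.

Section Walks.

Variables (T : finType) (e : rel T) (b : pred T).
Hypothesis uniq_e : forall x t, path e x t -> uniq (x :: t).

(** The starting point [x] is left out of the listed sequences. By [uniq_e] a walk never repeats a
    vertex, so filtering [bounded_seqs] loses none. *)
Definition walks x := [seq t <- bounded_seqs T | path e x t && b (last x t)].

Lemma size_path_e x t : path e x t -> (size t < #|T|)%N.
Proof. by move/uniq_e/card_uniqP=> cxt; move: (max_card [in x :: t]); rewrite cxt. Qed.

Lemma mem_walks x t : (t \in walks x) = path e x t && b (last x t).
Proof.
rewrite mem_filter mem_bounded_seqs; case: (boolP (path e x t)) => //= ext.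
by rewrite (ltnW (size_path_e ext)) andbT.
Qed.

Lemma uniq_walks x : uniq (walks x).
Proof. by rewrite filter_uniq ?uniq_bounded_seqs. Qed.

(** Split by the first step: a walk is empty, which requires [b x], or moves to some [u] and
    continues from there. This yields the recursions for both U and D. *)
Lemma big_walks (V : nmodType) (G : seq T -> V) x :
  \sum_(t <- walks x) G t = (if b x then G [::] else 0)
    + \sum_(u | e x u) \sum_(t <- walks u) G (u :: t).
Proof.
set r := (if b x then [:: [::]] else [::])
  ++ [seq u :: t | u <- enum (e x), t <- walks u].
have pr : perm_eq (walks x) r.
  apply: uniq_perm (uniq_walks x) _ _ => [|[|u t]].
  - rewrite cat_uniq; apply/and3P; split; first by case: (b x).
      by apply/hasPn=> s /allpairsPdep[u [t [_ _ ->]]]; case: (b x).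
    apply: allpairs_uniq_dep => [|u _|]; rewrite ?enum_uniq ?uniq_walks //.
    by move=> [u t] [u' t'] _ _ /= [-> ->].
  - rewrite mem_walks mem_cat /=; case: (b x) => //=.
    by apply/esym/negP=> /allpairsPdep[u [t []]].
  rewrite mem_walks mem_cat.
  have -> : (u :: t \in if b x then [:: [::]] else [::]) = false.
    by case: (b x).
  apply/andP/allpairsPdep => /= [[/andP[exu put] bl] | [u' [t' []]]].
    by exists u, t; rewrite mem_enum mem_walks put.
  rewrite mem_enum mem_walks => exu /andP[p bl] [-> ->].
  by rewrite p bl -topredE /= andbT in exu *.
rewrite (perm_big _ pr) big_cat big_allpairs_dep big_enum /=; congr (_ + _).
by case: (b x); rewrite ?big_seq1 ?big_nil.
Qed.

End Walks.

(** * Sums over the chains above and below an element *)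

Section ChainSums.

Context {d : Order.disp_t} {P : finPOrderType d}.
Implicit Types (x y v : P) (s t : seq P).

(** Both kinds of walks start next to [x] and move away from it; hence those in [downs] are listed
    in descending order and must be reversed to form a chain. *)
Definition ups x : seq (seq P) := walks covers is_max x.
Definition downs x : seq (seq P) := walks (fun y z => covers z y) is_min x.

Lemma uniq_path_covers x t : path covers x t -> uniq (x :: t).
Proof.
by move/path_covers_lt => p; apply: (sorted_uniq lt_trans ltxx); exact: p.
Qed.

Lemma uniq_path_covers_rev x t :
  path (fun y z => covers z y) x t -> uniq (x :: t).
Proof.
move/path_covers_gt => p.
by apply: (sorted_uniq (rev_trans lt_trans) ltxx); exact: p.
Qed.

Lemma mem_ups x t : (t \in ups x) = path covers x t && is_max (last x t).
Proof. exact: mem_walks uniq_path_covers _ _. Qed.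

Lemma mem_downs x t :
  (t \in downs x) = path (fun y z => covers z y) x t && is_min (last x t).
Proof. exact: mem_walks uniq_path_covers_rev _ _. Qed.

Lemma maximal_chain_cat v s t :
  maximal_chain (rev s ++ v :: t) = (s \in downs v) && (t \in ups v).
Proof.
rewrite mem_downs mem_ups.
case/lastP: s => [|s x] /=; first by rewrite maximal_chain_cons andbCA.
rewrite rev_rcons maximal_chain_cons cat_path last_cat /= last_rcons.
rewrite -(rev_path covers v) last_rcons belast_rcons rev_cons rcons_path.
by rewrite -!andbA; do !bool_congr.
Qed.

Lemma maximal_chain_size s : maximal_chain s -> (size s <= #|P|)%N.
Proof.
case: s => // x s; case/andP=> /uniq_path_covers u _.
by rewrite -(card_uniqP u) max_card.
Qed.

Lemma downs_notin v t : t \in downs v -> v \notin t.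
Proof. by rewrite mem_downs => /andP[/uniq_path_covers_rev /andP[]]. Qed.

Lemma index_downs v s t : s \in downs v -> index v (rev s ++ v :: t) = size s.
Proof.
move/downs_notin => vs.
by rewrite index_cat mem_rev (negbTE vs) /= eqxx addn0 size_rev.
Qed.

(** Cutting at [v] is a bijection between the maximal chains through [v] and pairs of walks, down
    and up from [v]. The sum thereby becomes a double sum that factors. *)
Lemma sum_maximal_chains (V : nmodType) v (F : seq P -> V) :
  sum_chains (fun s => maximal_chain s && (v \in s)) F =
  \sum_(s <- downs v) \sum_(t <- ups v) F (rev s ++ v :: t).
Proof.
rewrite -(big_allpairs_dep (h := fun s t => rev s ++ v :: t)).
apply: sum_chains_seq => [|s].
  apply: allpairs_uniq; rewrite ?uniq_walks //.
  move=> [s t] [s' t'] /allpairsPdep[a [b [da _ [sa tb]]]].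
  case/allpairsPdep=> a' [b' [da' _ [sa' tb']]] /= eq_st.
  (* The position of [v] recovers the length of the lower part, because [v] does not occur in it; so
     the cut is unique. *)
  have eq_sz : size (rev s) = size (rev s').
    rewrite !size_rev -(@index_downs v s t) -?(@index_downs v s' t') ?eq_st //.
      by rewrite sa'.
    by rewrite sa.
  move/eqP: eq_st; rewrite eqseq_cat // => /andP[/eqP eq_s /eqP[->]].
  by rewrite -[s]revK eq_s revK.
apply/allpairsPdep/andP => [[a [b [da ub ->]]] | [/andP[ms vs] _]].
  have ms : maximal_chain (rev a ++ v :: b) by rewrite maximal_chain_cat da.
  by rewrite ms maximal_chain_size // mem_cat mem_head orbT.
case/splitPr: vs ms => a b; rewrite -[a]revK maximal_chain_cat => /andP[da ub].
by exists (rev a), b.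
Qed.

Lemma sum_chain_to_top (V : nmodType) x (F : seq P -> V) :
  sum_chains (chain_to_top x) F = \sum_(t <- ups x) F (x :: t).
Proof.
rewrite -(big_map (cons x) xpredT F).
apply: sum_chains_seq => [|[|y t]].
- by rewrite map_inj_uniq ?uniq_walks // => ? ? [].
- by rewrite /chain_to_top /=; apply/mapP=> -[].
rewrite chain_to_top_cons; case: eqVneq => [->|yx] /=; last first.
  by apply/mapP=> -[? _ [eyx]]; rewrite eyx eqxx in yx.
rewrite mem_map; last by move=> ? ? [].
rewrite mem_ups; case: (boolP (path _ _ _)) => //= p.
by rewrite (size_path_e uniq_path_covers p) andbT.
Qed.

Context {S : unitRingType}.
Implicit Types (g : {ffun P -> S}) (C : S).

Lemma rev_prod_cons g x t : rev_prod g (x :: t) = rev_prod g t * g x.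
Proof. by rewrite /rev_prod rev_cons -cats1 big_cat big_seq1. Qed.

(** These are U and D; [up_label] is F, and [down_label] is its dual. Walks in [downs] already
    descend, so [down_sum] multiplies them without reversal. *)
Definition up_sum g x : S := \sum_(t <- ups x) rev_prod g t.
Definition down_sum g x : S := \sum_(t <- downs x) \prod_(y <- t) g y.
Definition up_label g : {ffun P -> S} := [ffun x => up_sum g x * g x].
Definition down_label g : {ffun P -> S} := [ffun x => g x * down_sum g x].

Lemma DeltaVE g : DeltaV g = Some (up_label g).
Proof.
congr Some; apply/ffunP=> x; rewrite !ffunE sum_chain_to_top big_distrl /=.
by apply: eq_bigr => t _; rewrite rev_prod_cons.
Qed.

(** The label 1 at [hat1] accounts for the empty walk from a maximal element. *)
Lemma up_sum_rec g x :
  up_sum g x = \sum_(u | hat_covers (inhat x) u) hat_label 1 (up_label g) u.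
Proof.
rewrite big_covers_above /up_sum (big_walks _ uniq_path_covers).
congr (_ + _); first by rewrite /rev_prod big_nil.
apply: eq_bigr => u _; rewrite /= ffunE big_distrl /=.
by apply: eq_bigr => t _; rewrite rev_prod_cons.
Qed.

(** The empty walk is the term 1 at [hat0]. The element [hat1] lies below nothing, so [C] is free
    and can be chosen to match [sum_below]. *)
Lemma down_sum_rec C g x :
  down_sum g x = \sum_(u | hat_covers u (inhat x)) hat_label C (down_label g) u.
Proof.
rewrite big_covers_below /down_sum (big_walks _ uniq_path_covers_rev).
congr (_ + _); first by rewrite big_nil.
apply: eq_bigr => u _; rewrite /= ffunE big_distrr /=.
by apply: eq_bigr => t _; rewrite big_cons.
Qed.

Lemma eq_up_sum g g' x :
  (forall y, (x < y)%O -> g y = g' y) -> up_sum g x = up_sum g' x.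
Proof.
move=> eqg; apply: eq_big_seq => t; rewrite mem_ups => /andP[p _].
apply: eq_big_seq => y; rewrite mem_rev => /(mem_path_covers_lt p); exact: eqg.
Qed.

Lemma eq_down_sum g g' x :
  (forall y, (y < x)%O -> g y = g' y) -> down_sum g x = down_sum g' x.
Proof.
move=> eqg; apply: eq_big_seq => t; rewrite mem_downs => /andP[p _].
apply: eq_big_seq => y /(mem_path_covers_gt p); exact: eqg.
Qed.

(** Common shape of toggles and elggots, with [K] the sum to be inverted; arguments about composites
    can then treat both at once. *)
Definition toggle_with (K : {ffun P -> S} -> P -> S) C v :
  partial_map {ffun P -> S} :=
  fun g => omap (fun a => set_label g v (C * a)) (pinv (K g v)).

Definition toggle_sum g v := down_sum g v * up_label g v.
Definition elggot_sum g v := down_label g v * up_sum g v.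

(** The cut falls just before [v], so [g v] joins the upper factor and turns U(v) into F(v). *)
Lemma antichain_toggleE C v : antichain_toggle C v =1 toggle_with toggle_sum C v.
Proof.
move=> g; rewrite /antichain_toggle /toggle_with; congr (omap _ (pinv _)).
rewrite sum_maximal_chains /toggle_sum ffunE /down_sum mulr_suml.
apply: eq_big_seq => s ds; rewrite /up_sum mulr_suml mulr_sumr.
apply: eq_bigr => t _.
rewrite index_downs // -(size_rev s) take_size_cat // drop_size_cat //.
by rewrite rev_prod_cons /rev_prod revK.
Qed.

Lemma antichain_elggotE C v : antichain_elggot C v =1 toggle_with elggot_sum C v.
Proof.
move=> g; rewrite /antichain_elggot /toggle_with; congr (omap _ (pinv _)).
rewrite sum_maximal_chains /elggot_sum ffunE /down_sum mulr_sumr mulr_suml.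
apply: eq_big_seq => s ds; rewrite /up_sum mulr_sumr; apply: eq_bigr => t _.
(* For the elggot the cut falls just after [v], so [v] is moved to the end of the lower part. *)
rewrite index_downs // -cat_rcons -(size_rev s) -(size_rcons (rev s) v).
rewrite take_size_cat // drop_size_cat //.
by rewrite {1}/rev_prod rev_rcons revK big_cons.
Qed.

(** Only chains through [v] contribute, and their elements are all comparable to [v]. *)
Lemma eq_toggle_sum g g' v : (forall y, (y >=< v)%O -> g y = g' y) ->
  toggle_sum g v = toggle_sum g' v.
Proof.
move=> eqg; rewrite /toggle_sum !ffunE (@eq_down_sum g g') ?(@eq_up_sum g g').
- by rewrite eqg // comparablexx.
- by move=> y lt; apply: eqg; exact: gt_comparable.
- by move=> y lt; apply: eqg; exact: lt_comparable.
Qed.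

Lemma eq_elggot_sum g g' v : (forall y, (y >=< v)%O -> g y = g' y) ->
  elggot_sum g v = elggot_sum g' v.
Proof.
move=> eqg; rewrite /elggot_sum !ffunE (@eq_down_sum g g') ?(@eq_up_sum g g').
- by rewrite eqg // comparablexx.
- by move=> y lt; apply: eqg; exact: gt_comparable.
- by move=> y lt; apply: eqg; exact: lt_comparable.
Qed.

End ChainSums.

(** * Composites of toggles, and their effect on [up_label] *)

Lemma pcomp_seq_cat (T : Type) (s1 s2 : seq (partial_map T)) x :
  pcomp_seq (s1 ++ s2) x = obind (pcomp_seq s1) (pcomp_seq s2 x).
Proof.
elim: s1 => [|F s1 IH] /=; first by case: (pcomp_seq s2 x).
by rewrite -[LHS]/(obind F (pcomp_seq (s1 ++ s2) x)) IH; case: (pcomp_seq s2 x).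
Qed.

Section Toggles.

Context {d : Order.disp_t} {P : finPOrderType d} {S : unitRingType}.
Implicit Types (g : {ffun P -> S}) (C : S) (u v : P).

Lemma toggle_with_Some (K : {ffun P -> S} -> P -> S) C v g g' :
  toggle_with K C v g = Some g' ->
  K g v != 0 /\ g' = set_label g v (C * (K g v)^-1).
Proof. by rewrite /toggle_with /pinv; case: eqP => //= _ [<-]. Qed.

(** Toggles at pairwise incomparable elements do not influence one another's sums, so every sum can
    be evaluated at the initial labeling [g]. *)
Lemma pcomp_seq_antichain (K : {ffun P -> S} -> P -> S) C
    (op : P -> partial_map {ffun P -> S}) (us : seq P) g g' :
  (forall g1 g2 v, (forall y, (y >=< v)%O -> g1 y = g2 y) -> K g1 v = K g2 v) ->
  (forall v, op v =1 toggle_with K C v) ->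
  uniq us -> {in us &, forall x y, (x >=< y)%O -> x = y} ->
  pcomp_seq (map op us) g = Some g' ->
  (forall u, u \in us -> K g u != 0 /\ g' u = C * (K g u)^-1) /\
  (forall u, u \notin us -> g' u = g u).
Proof.
move=> localK opE; elim: us g' => [|w us IH] g' /=; first by move=> _ _ [->].
case/andP=> wus uus anti.
rewrite -[X in X = Some g']/(obind (op w) (pcomp_seq (map op us) g)).
case E: (pcomp_seq _ g) => [g1|] //=; rewrite opE => /toggle_with_Some[Kw ->].
have [|in_us out_us] := IH _ uus _ E.
  by move=> x y xus yus; apply: anti; rewrite inE ?xus ?yus orbT.
(* The maps applied before the one at [w] changed only labels of elements incomparable to [w]. *)
have eqK : K g1 w = K g w.
  apply: localK => y cyw; apply: out_us; apply: contraNN wus => yus.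
  by rewrite -(anti y w) ?mem_head // inE yus orbT.
rewrite eqK in Kw *; split=> u; rewrite inE ffunE.
  by case: eqVneq => [->|_] //=; exact: in_us.
by case: eqVneq => //= _; exact: out_us.
Qed.

Hypothesis skewS : GRing.field_axiom S.

Lemma skew_mul_neq0 (x y : S) : x * y != 0 -> x != 0 /\ y != 0.
Proof.
by move=> xy0; split; apply: contraNneq xy0 => ->; rewrite ?mul0r ?mulr0.
Qed.

Lemma unit_neq0 (x : S) : x \is a GRing.unit -> x != 0.
Proof. by apply: contraTneq => ->; rewrite unitr0. Qed.

Variables (C : S) (v : P).
Hypotheses (centralC : forall x : S, C * x = x * C) (C_neq0 : C != 0).

Lemma ThetaSome (f h : {ffun P -> S}) : Theta C f = Some h ->
  (forall x, f x \is a GRing.unit) /\ h = [ffun x => C * (f x)^-1].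
Proof.
by rewrite /Theta; case: forallP => // fn0 [<-]; split=> // x; apply: skewS.
Qed.

(* [g1] is [g] after the toggles at the elements covered by [v], [g2] is [g1]
   after the toggle or elggot at [v], and [g3] is [g2] after the elggots. *)
Variables (g g1 g2 g3 h3 : {ffun P -> S}) (c : S).
Hypothesis up_unit : forall x, up_label g x \is a GRing.unit.
Hypothesis g1_covered : forall u, covers u v ->
  toggle_sum g u != 0 /\ g1 u = C * (toggle_sum g u)^-1.
Hypothesis g1_other : forall u, ~~ covers u v -> g1 u = g u.
Hypothesis g2E : g2 = set_label g1 v c.
Hypothesis g3_covered : forall u, covers u v ->
  elggot_sum g2 u != 0 /\ g3 u = C * (elggot_sum g2 u)^-1.
Hypothesis g3_other : forall u, ~~ covers u v -> g3 u = g2 u.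

Let h := [ffun x => C * (up_label g x)^-1].

Let C_unit : C \is a GRing.unit. Proof. exact: skewS. Qed.

Let up_sum_unit x : up_sum g x \is a GRing.unit.
Proof.
have := unit_neq0 (up_unit x); rewrite ffunE => /skew_mul_neq0[/skewS //].
Qed.

Let g_unit x : g x \is a GRing.unit.
Proof.
have := unit_neq0 (up_unit x); rewrite ffunE => /skew_mul_neq0[_ /skewS //].
Qed.

Lemma covered_incomparable u y : covers u v -> covers y v -> (u < y)%O = false.
Proof.
by move=> uv yv; apply/negP=> /(covers_between uv); apply; exact: covers_lt.
Qed.

Lemma g1_above u : covers u v || (u == v) -> forall y, (u < y)%O -> g1 y = g y.
Proof.
move=> uv y uy; apply: g1_other; apply/negP=> yv; case/orP: uv => [uv|/eqP uv].
  by rewrite covered_incomparable in uy.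
by have := lt_trans uy (covers_lt yv); rewrite uv ltxx.
Qed.

Lemma down_sum_covered u : covers u v -> down_sum g1 u = down_sum g u.
Proof.
move=> uv; apply: eq_down_sum => y yu; apply: g1_other; apply/negP=> yv.
by rewrite covered_incomparable in yu.
Qed.

(** The toggle sum is D(u) F(u), so the new label is C F(u)^-1 D(u)^-1. Nothing below [u] has
    changed, and multiplying by D(u) on the right cancels the last factor. *)
Lemma down_label_covered u : covers u v ->
  down_label g1 u = C * (up_label g u)^-1.
Proof.
move=> uv; have [sum0 g1u] := g1_covered uv.
have [/skewS D_unit _] := skew_mul_neq0 sum0.
by rewrite ffunE down_sum_covered // g1u invrM // !mulrA mulrVK.
Qed.

(** By [down_label_covered], the recursion for D(v) in [g1] agrees term by term with the sum of [h]
    below [v]. *)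
Lemma sum_below_toggled : sum_below C h v = down_sum g1 v.
Proof.
rewrite (down_sum_rec C); apply: eq_bigr => -[[u|]|] //= uv.
by rewrite down_label_covered // ffunE.
Qed.

Lemma covers_irr : covers v v = false.
Proof. by apply/negP=> /covers_lt; rewrite ltxx. Qed.

Lemma g1_v : g1 v = g v.
Proof. by apply: g1_other; rewrite covers_irr. Qed.

Lemma g3_v : g3 v = c.
Proof. by rewrite g3_other ?covers_irr // g2E ffunE eqxx. Qed.

Lemma g3_unchanged x : ~~ covers x v -> x != v -> g3 x = g x.
Proof.
by move=> xv xnv; rewrite g3_other // g2E ffunE (negbTE xnv) g1_other.
Qed.

Lemma up_sum1_v : up_sum g1 v = up_sum g v.
Proof. by apply: eq_up_sum; apply: g1_above; rewrite eqxx orbT. Qed.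

Lemma up_sum3_v : up_sum g3 v = up_sum g v.
Proof.
apply: eq_up_sum => y vy; apply: g3_unchanged.
  by apply/negP=> /covers_lt yv; have := lt_trans vy yv; rewrite ltxx.
by apply: contraTneq vy => ->; rewrite ltxx.
Qed.

(** Changing the label at [v] may change U(u) to some U'. The elggot sum is then C F(u)^-1 U', so
    the new label is C U'^-1 F(u) C^-1, and multiplying by U' on the left restores F(u) because [C]
    is central. *)
Lemma up_label3_covered u : covers u v -> up_label g3 u = up_label g u.
Proof.
move=> uv; have [sum0 g3u] := g3_covered uv.
have up32 : up_sum g3 u = up_sum g2 u.
  apply: eq_up_sum => y uy; apply: g3_other; apply/negP=> yv.
  by rewrite covered_incomparable in uy.
have down21 : down_label g2 u = down_label g1 u.
  have nuv : (u == v) = false by apply: lt_eqF; exact: covers_lt.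
  rewrite !ffunE g2E ffunE nuv; congr (_ * _); apply: eq_down_sum => y yu.
  by rewrite ffunE lt_eqF //; exact: lt_trans yu (covers_lt uv).
have [_ /skewS U_unit] := skew_mul_neq0 sum0.
rewrite ffunE g3u up32 /elggot_sum down21 down_label_covered //.
rewrite invrM ?(unitrMl, unitrV) // invrM ?unitrV // invrK.
by rewrite centralC !mulrA divrr // mul1r divrK.
Qed.

(** Induction from the top down, on the number of elements above [x]. If [v] does not cover [x], the
    recursion for U(x) meets only elements other than [v], where the induction hypothesis
    applies. *)
Lemma up_label3 x : x != v -> up_label g3 x = up_label g x.
Proof.
have [n] := ubnP #|[set y | (x < y)%O]|; elim: n x => // n IH x ltn xv.
case: (boolP (covers x v)) => [|nxv]; first exact: up_label3_covered.
rewrite [LHS]ffunE [RHS]ffunE g3_unchanged // !up_sum_rec; congr (_ * _).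
apply: eq_bigr => -[[y|]|] //= xy; apply: IH; last first.
  by apply: contraNneq nxv => <-.
apply: leq_trans (proper_card _) ltn; apply/properP; split.
  by apply/subsetP=> z; rewrite !inE; exact: lt_trans (covers_lt xy).
by exists y; rewrite !inE ?ltxx //; exact: covers_lt.
Qed.

Lemma up_label3_v : up_label g3 v = up_sum g v * c.
Proof. by rewrite ffunE up_sum3_v g3_v. Qed.

(** Inverting the labels of [h] above [v] gives F(u) C^-1, and C^-1 at [hat1]; they add up to U(v)
    C^-1 by [up_sum_rec]. *)
Lemma psum_above_Theta b : psum_above C h v = Some b -> b = C * (up_sum g v)^-1.
Proof.
rewrite /psum_above /parallel_sum /pinv.
case: ifP => // _; case: ifP => // _ [<-].
set s := \sum_(_ | _) _; have -> : s = up_sum g v * C^-1.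
  rewrite up_sum_rec mulr_suml; apply: eq_bigr => -[[u|]|] //= _.
    by rewrite ffunE invrM ?unitrV // invrK.
  by rewrite mul1r.
by rewrite invrM ?unitrV // invrK.
Qed.

Lemma Theta_up_label3 c' : h3 = [ffun x => C * (up_label g3 x)^-1] ->
  C * (up_label g3 v)^-1 = c' -> h3 = set_label h v c'.
Proof.
move=> -> eqv; apply/ffunP=> x; rewrite [LHS]ffunE [RHS]ffunE.
by case: eqVneq => [->|xv] //; rewrite up_label3 // [h x]ffunE.
Qed.

(** With D(v) taken in [g1], and F(v), U(v) in [g], both sides reduce to D(v) F(v) U(v)^-1. *)
Lemma toggle_label : down_sum g1 v \is a GRing.unit ->
  c = C * (toggle_sum g1 v)^-1 ->
  C * (up_label g3 v)^-1 =
  sum_below C h v * (h v)^-1 * (C * (up_sum g v)^-1).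
Proof.
move=> D_unit cE; rewrite up_label3_v cE /toggle_sum.
have -> : up_label g1 v = up_label g v.
  by rewrite !ffunE up_sum1_v g1_v.
rewrite sum_below_toggled [h v]ffunE.
rewrite invrM ?(unitrMl, unitrV) // invrM ?(unitrMl, unitrV) // invrK.
rewrite invrM ?unitrV // invrK mulrA (mulrA C) centralC mulrK //.
by rewrite !mulrA divrK.
Qed.

(** With D(v) taken in [g1], both sides reduce to g(v) D(v), using F(v) = U(v) g(v) and the
    centrality of [C]. *)
Lemma elggot_label : down_sum g1 v \is a GRing.unit ->
  c = C * (elggot_sum g1 v)^-1 ->
  C * (up_label g3 v)^-1 =
  C * (up_sum g v)^-1 * (h v)^-1 * sum_below C h v.
Proof.
move=> D_unit cE; rewrite up_label3_v cE /elggot_sum up_sum1_v sum_below_toggled.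
rewrite [h v]ffunE [up_label g v]ffunE [down_label g1 v]ffunE g1_v.
rewrite invrM ?(unitrMl, unitrV) // invrM ?(unitrMl, unitrV) // invrK.
rewrite mulrA (mulrA C) centralC mulrK // mulrK //.
rewrite [X in _ * X * _]invrM ?(unitrMl, unitrV) // invrK.
by rewrite !mulrA divrK // centralC mulrK.
Qed.

End Toggles.

(** * Assembly of the two identities *)

(** Extracts the three stages of a starred map in the form assumed in the section on toggles. The
    generic [K] for the middle map serves [T_star] and [E_star] alike. *)
Lemma star_Some (d : Order.disp_t) (P : finPOrderType d) (S : unitRingType)
    (K : {ffun P -> S} -> P -> S) (mid : partial_map {ffun P -> S})
    (C : S) (v : P) (vs : seq P) (g g3 : {ffun P -> S}) :
  uniq vs -> (forall u, (u \in vs) = covers u v) ->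
  mid =1 toggle_with K C v ->
  pcomp_seq (map (antichain_elggot C) vs ++ [:: mid]
             ++ map (antichain_toggle C) (rev vs)) g = Some g3 ->
  exists g1 g2 : {ffun P -> S},
    [/\ forall u, covers u v ->
          toggle_sum g u != 0 /\ g1 u = C * (toggle_sum g u)^-1,
        forall u, ~~ covers u v -> g1 u = g u,
        K g1 v != 0 /\ g2 = set_label g1 v (C * (K g1 v)^-1),
        forall u, covers u v ->
          elggot_sum g2 u != 0 /\ g3 u = C * (elggot_sum g2 u)^-1 &
        forall u, ~~ covers u v -> g3 u = g2 u].
Proof.
move=> uvs vsP midE; rewrite !pcomp_seq_cat.
case E1: (pcomp_seq _ g) => [g1|] //.
rewrite -[obind _ (Some g1)]/(mid g1) midE.
case E2: (toggle_with _ _ _ g1) => [g2|] //= E3; exists g1, g2.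
(* Comparable elements covered by the same [v] coincide, since neither can lie strictly below the
   other. *)
have anti : {in vs &, forall x y, (x >=< y)%O -> x = y}.
  move=> x y; rewrite !vsP => xv yv; rewrite /Order.comparable !le_eqVlt.
  by rewrite !(covered_incomparable (v := v)) // !orbF => /orP[] /eqP.
have anti_rev : {in rev vs &, forall x y, (x >=< y)%O -> x = y}.
  by move=> x y; rewrite !mem_rev; exact: anti.
have [|in1 out1] := pcomp_seq_antichain eq_toggle_sum (antichain_toggleE C)
  _ anti_rev E1; first by rewrite rev_uniq.
have [in3 out3] := pcomp_seq_antichain eq_elggot_sum (antichain_elggotE C)
  uvs anti E3.
split; [| | exact: toggle_with_Some E2 | |] => u uv.
- by apply: in1; rewrite mem_rev vsP.
- by apply: out1; rewrite mem_rev vsP.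
- by apply: in3; rewrite vsP.
- by apply: out3; rewrite vsP.
Qed.

Lemma agree_Theta_DeltaV (d : Order.disp_t) (P : finPOrderType d)
    (S : unitRingType) (C : S) (star ord : partial_map {ffun P -> S}) :
  (forall g g3 h a b, star g = Some g3 -> Theta C (up_label g) = Some h ->
     Theta C (up_label g3) = Some a -> ord h = Some b -> a = b) ->
  agree (Theta C \p DeltaV \p star) (ord \p Theta C \p DeltaV).
Proof.
move=> H g a b; rewrite /Defs.pcomp DeltaVE.
case Estar: (star g) => [g3|] //.
rewrite -[obind _ (Some g3)]/(obind (Theta C) (DeltaV g3)) DeltaVE /=.
by case EU: (Theta C (up_label g)) => [h|] //; exact: H Estar EU.
Qed.

Theorem theorem5p20 (d : Order.disp_t) (P : finPOrderType d)
    (S : unitRingType) (skewS : GRing.field_axiom S)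
    (infS : contains_infinite_field S)
    (C : S) (centralC : forall x : S, C * x = x * C)
    (v : P) (vs : seq P) (uniq_vs : uniq vs)
    (vsP : forall u : P, (u \in vs) = covers u v) :
  agree (Theta C \p DeltaV \p T_star C v vs)
        (order_toggle C v \p Theta C \p DeltaV)
  /\
  agree (Theta C \p DeltaV \p E_star C v vs)
        (order_elggot C v \p Theta C \p DeltaV).
Proof.
split; apply: agree_Theta_DeltaV => g g3 h a b Estar.
  case/(ThetaSome skewS)=> up_unit -> /(ThetaSome skewS)[_ aE].
  rewrite /order_toggle {1}/pinv; case: eqP => //= hv0.
  case Eabove: (psum_above _ _ _) => [p|] //= [<-].
  (* If [C] were 0, the labeling [h] would vanish at [v] and the order toggle would be undefined
     there. *)
  have C0 : C != 0 by apply/eqP=> C0; apply: hv0; rewrite ffunE C0 mul0r.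
  have [g1 [g2 [in1 out1 [K0 g2E] in3 out3]]] :=
    star_Some uniq_vs vsP (antichain_toggleE C v) Estar.
  (* The sum inverted by the middle toggle is D(v) times a label, so its being nonzero makes D(v)
     invertible. *)
  have [/skewS D_unit _] := skew_mul_neq0 K0.
  rewrite (psum_above_Theta skewS C0 up_unit Eabove).
  apply: (Theta_up_label3 skewS centralC C0 up_unit in1 out1 g2E in3 out3 aE).
  exact: (toggle_label skewS centralC C0 up_unit in1 out1 g2E out3 D_unit).
case/(ThetaSome skewS)=> up_unit -> /(ThetaSome skewS)[_ aE].
rewrite /order_elggot {1}/pinv; case: eqP => //= hv0.
case Eabove: (psum_above _ _ _) => [p|] //= [<-].
have C0 : C != 0 by apply/eqP=> C0; apply: hv0; rewrite ffunE C0 mul0r.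
have [g1 [g2 [in1 out1 [K0 g2E] in3 out3]]] :=
  star_Some uniq_vs vsP (antichain_elggotE C v) Estar.
have D_unit : down_sum g1 v \is a GRing.unit.
  have [+ _] := skew_mul_neq0 K0.
  by rewrite ffunE => /skew_mul_neq0[_ /skewS].
rewrite (psum_above_Theta skewS C0 up_unit Eabove).
apply: (Theta_up_label3 skewS centralC C0 up_unit in1 out1 g2E in3 out3 aE).
exact: (elggot_label skewS centralC C0 up_unit in1 out1 g2E out3 D_unit).
Qed.
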